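(* Let $\Gamma(T)=(\gamma_n(T))$, $T\ge T_0$, be a family of sequences of real numbers satisfying assumptions (A1) and (A2) below. Then for every $\varepsilon>0$ and $b\ge1$ there is $\ell_0(b,\varepsilon)$ such that for all $\ell\ge\ell_0(b,\varepsilon)$, $$\frac1\ell\int_b^{b+\ell}\mathfrak F_\Gamma(\alpha,T)\,d\alpha>\frac12-\varepsilon+o(1)\quad\text{as }T\to\infty.$$
   Context: Elements of $\Gamma(T)$ need not be distinct and are counted with multiplicity. (A1): there is $\lambda>0$ with $\liminf_{T\to\infty}\frac{\#\{n:\gamma_n(T)\in(0,T]\}}{\frac{\lambda T}{2\pi}\log T}=1$. Form factor: with $w(u)=\frac{4}{4+u^2}$, $\mathfrak F_\Gamma(\alpha,T)=\left(\frac{\lambda T}{2\pi}\log T\right)^{-1}\sum_{\gamma,\gamma'\in(0,T]\cap\Gamma(T)}T^{i\lambda\alpha(\gamma-\gamma')}w(\gamma-\gamma')$. A Borel measure $\nu$ is a limiting measure for $\mathfrak F_\Gamma$ in $[-\Delta,\Delta]$ if for every continuous $\varphi$ compactly supported in $(-\Delta,\Delta)$, $\lim_{T\to\infty}\int\varphi(\alpha)\mathfrak F_\Gamma(\alpha,T)\,d\alpha=\int\varphi\,d\nu$. (A2): there exist $\Delta>0$ and a finite Borel measure $\nu$ which is a limiting measure for $\mathfrak F_\Gamma$ in $[-\Delta,\Delta]$. *)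

(* Defs.v *)
From HB Require Import structures.
From mathcomp Require Import all_boot all_order all_algebra.
From mathcomp Require Import finmap complex.
From mathcomp Require Import all_classical all_reals all_analysis.

Set Implicit Arguments.
Unset Strict Implicit.
Unset Printing Implicit Defensive.

Import Order.TTheory GRing.Theory Num.Theory.
Import numFieldNormedType.Exports.

Local Open Scope classical_set_scope.
Local Open Scope ring_scope.

(* A family of sequences is [gam : R -> nat -> R], where [gam T n] stands for
   gamma_n(T).  Finite sequences are covered by padding with nonpositive terms,
   as only the terms in (0, T] matter.  Multiplicities are accounted for by
   working with indices [n] rather than with values. *)
Definition window {R : realType} (gam : R -> nat -> R) (T : R) : set nat :=
  [set n | 0 < gam T n <= T].

(* [fset_set] is only meaningful on finite sets. *)
Definition wcount {R : realType} (gam : R -> nat -> R) (T : R) : nat :=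
  #|` fset_set (window gam T)|%fset.

Definition density {R : realType} (lam T : R) : R :=
  lam * T / (2 * pi) * ln T.

Definition assumptionA1 {R : realType} (lam : R) (gam : R -> nat -> R) : Prop :=
  limf_einf (fun T : R => ((wcount gam T)%:R / density lam T)%:E) +oo_R = 1%E.

Definition weight {R : realType} (u : R) : R := 4 / (4 + u ^+ 2).

(* T ^ (i x) = exp (i x log T), for T > 0. *)
Definition imag_pow {R : realType} (T x : R) : R[i] :=
  (cos (x * ln T) +i* sin (x * ln T))%C.

Definition pair_sum {R : realType} (lam : R) (gam : R -> nat -> R)
    (alpha T : R) : R[i] :=
  \sum_(m \in window gam T) \sum_(n \in window gam T)
    imag_pow T (lam * alpha * (gam T m - gam T n))
      * (weight (gam T m - gam T n))%:C%C.

(* The double sum is a real number, see [pair_sum_real] below. *)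
Definition form_factor {R : realType} (lam : R) (gam : R -> nat -> R)
    (alpha T : R) : R :=
  (density lam T)^-1 * complex.Re (pair_sum lam gam alpha T).

Definition compactly_supported_in {R : realType} (phi : R -> R) (A : set R) :
    Prop :=
  let supp := closure [set x | phi x != 0] in compact supp /\ supp `<=` A.

Definition limiting_measure {R : realType} (lam : R) (gam : R -> nat -> R)
    (Delta : R)
    (nu : {measure set (measurableTypeR R) -> \bar R}) : Prop :=
  forall phi : R -> R, continuous phi ->
    compactly_supported_in phi `]- Delta, Delta[ ->
    (fun T : R => \int[@lebesgue_measure R]_alpha
                    (phi alpha * form_factor lam gam alpha T)) @ +oo_R
      --> \int[nu]_alpha phi alpha.

Definition assumptionA2 {R : realType} (lam : R) (gam : R -> nat -> R) : Prop :=
  exists Delta : R, 0 < Delta /\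
  exists nu : {finite_measure set (measurableTypeR R) -> \bar R},
    limiting_measure lam gam Delta nu.

Lemma pair_sum_real (R : realType) (lam : R) (gam : R -> nat -> R)
    (alpha T : R) : finite_set (window gam T) ->
  complex.Im (pair_sum lam gam alpha T) = 0.
Proof.
move=> fW; rewrite /pair_sum fsbig_finite//=.
under eq_bigr do rewrite fsbig_finite//=.
set s := fset_set _ : seq nat.
pose S := \sum_(m <- s) \sum_(n <- s)
  (sin (lam * alpha * (gam T m - gam T n) * ln T)
     * weight (gam T m - gam T n)).
transitivity S.
  rewrite raddf_sum; apply: eq_bigr => m _.
  rewrite raddf_sum; apply: eq_bigr => n _ /=.
  by rewrite mulr0 add0r.
suff SN : S = - S.
  by apply/eqP; rewrite -[_ == 0](mulrn_eq0 _ 2) mulr2n {1}SN addNr.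
rewrite {1}/S exchange_big -sumrN; apply: eq_bigr => m _ /=.
rewrite -sumrN; apply: eq_bigr => n _.
by rewrite /weight -(opprB (gam T m)) sqrrN mulrN mulNr sinN mulNr.
Qed.

(* Main.v *)
Require Import Defs.
From mathcomp Require Import all_boot all_order all_algebra.
From mathcomp Require Import finmap complex ring lra.
From mathcomp Require Import all_classical all_reals all_analysis.
From mathcomp Require Import measurable_realfun.

(** For fixed [T] the form factor [F] is a finite sum of cosines
    [c_i cos (x_i a)] with [c_i >= 0], and [F >= 0] because the weight is a
    positive definite function.  Let [P] and [Q] be the first and second
    primitives of [F] vanishing at [0].  As [P] is nondecreasing,
    [L P(L) >= Q(L)], and the diagonal terms, where [x_i = 0], contribute
    [(N/D) L^2/2] to [Q(L)]; hence [P(L) >= (1 - o(1)) L/2] by (A1).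
    It remains to bound [P(b)] independently of [T]: by positivity of the [c_i],
    the integral of [F] against a tent function is largest when the tent is
    centered at [0], that is [Q(a+r) + Q(a-r) - 2 Q(a) <= 2 Q(r)], and (A2)
    bounds [Q(r)/r], which is the integral of [F] against half of the tent of
    radius [r].
    The error term [o(1)] is absorbed in [eps]. *)

Set Implicit Arguments.
Unset Strict Implicit.
Unset Printing Implicit Defensive.

Import Order.TTheory GRing.Theory Num.Theory.
Import numFieldNormedType.Exports.

Local Open Scope classical_set_scope.
Local Open Scope ring_scope.

(** * Positive definiteness of the weight *)

(** Over the complex numbers the form is the integral over [t > 0] of
    [|\sum_j c j * exp (- z j * t)|^2]. An algebraic induction, removing one node at a time,
    replaces this integral. *)
Lemma cauchy_kernel_ge0 (C : numClosedFieldType) (I : Type) (s : seq I)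
    (z c : I -> C) : (forall i, 0 < z i + (z i)^* ) ->
  0 <= \sum_(j <- s) \sum_(k <- s) c j * (c k)^* / (z j + (z k)^* ).
Proof.
move=> z_gt0.
(* If a denominator vanished, so would its conjugate, yet together they add up to two positive
   numbers. *)
have K_neq0 j k : z j + (z k)^* != 0.
  apply/eqP => jk0.
  have kj0 : (z j)^* + z k = 0 by rewrite -[z k]conjCK -rmorphD jk0 rmorph0.
  have := addr_gt0 (z_gt0 j) (z_gt0 k).
  have -> : z j + (z j)^* + (z k + (z k)^* ) =
    (z j + (z k)^* ) + ((z j)^* + z k) by ring.
  by rewrite jk0 kj0 addr0 ltxx.
have K_neq0' j k : (z j)^* + z k != 0 by rewrite addrC.
elim: s c => [|i s IH] c; first by rewrite big_nil.
(* Schur complement of the entry [(i, i)]: it is again a Cauchy kernel, with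
   coefficients multiplied by [a], and [a i = 0]. *)
pose a j := (z j - z i) / (z j + (z i)^* ).
pose v := \sum_(j <- i :: s) c j / (z j + (z i)^* ).
have -> : \sum_(j <- i :: s) \sum_(k <- i :: s)
      c j * (c k)^* / (z j + (z k)^* ) =
    (z i + (z i)^* ) * (v * v^* ) +
    \sum_(j <- i :: s) \sum_(k <- i :: s)
      (c j * a j) * (c k * a k)^* / (z j + (z k)^* ).
  rewrite {1}/v rmorph_sum !mulr_suml mulr_sumr -big_split/=.
  apply: eq_bigr => j _; rewrite !mulr_sumr -big_split/=.
  apply: eq_bigr => k _; rewrite /a !rmorphM/= !fmorphV !rmorphB !rmorphD/=.
  by rewrite conjCK; field; rewrite !K_neq0 ?K_neq0'.
have a0 : a i = 0 by rewrite /a subrr mul0r.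
apply: addr_ge0; first by rewrite mulr_ge0 ?mul_conjC_ge0// ltW.
rewrite big_cons big1 ?add0r; last by move=> k _; rewrite a0 !(mulr0, mul0r).
under eq_bigr do rewrite big_cons a0 mulr0 conjC0 mulr0 mul0r add0r.
exact: IH.
Qed.

Lemma weight_ge0 (R : realType) (u : R) : 0 <= weight u.
Proof. by rewrite /weight divr_ge0// addr_ge0// sqr_ge0. Qed.

(* [weight u = (2 + i u)^-1 + (2 - i u)^-1] is a sum of two Cauchy kernels. *)
Lemma weight_positive_definite (R : realType) (I : Type) (s : seq I)
    (g : I -> R) (t : R) :
  0 <= \sum_(m <- s) \sum_(n <- s) cos (t * (g m - g n)) * weight (g m - g n).
Proof.
pose c m : R[i] := (cos (t * g m) +i* sin (t * g m))%C.
(* Real part 1 yields the denominators [2 + i e (g m - g n)]; the signs [e = 1] and [e = -1] give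
   the two kernels. *)
pose z (e : R) m : R[i] := (1 +i* (e * g m))%C.
have z_gt0 e i : 0 < z e i + (z e i)^*.
  by rewrite /z ltcE/= subrr eqxx/= addr_gt0.
have cc m n : c m * (c n)^* =
    (cos (t * (g m - g n)) +i* sin (t * (g m - g n)))%C.
  apply/eqP; rewrite eq_complex /c/= mulrBr cosB sinB.
  by apply/andP; split; apply/eqP; ring.
have zz m n : (z 1 m + (z 1 n)^* )^-1 + (z (-1) m + (z (-1) n)^* )^-1 =
    (weight (g m - g n))%:C%C.
  have u_neq0 : 4 + (g m - g n) ^+ 2 != 0.
    by rewrite gt_eqF// ltr_pwDl// sqr_ge0.
  apply/eqP; rewrite eq_complex /z /weight/=.
  apply/andP; split; apply/eqP; rewrite !mul1r !mulN1r; first by field.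
  by field; rewrite -opprD sqrrN.
have := addr_ge0 (cauchy_kernel_ge0 s c (z_gt0 1))
  (cauchy_kernel_ge0 s c (z_gt0 (-1))).
rewrite lecE => /andP[_]; congr (_ <= _); rewrite -big_split raddf_sum.
apply: eq_bigr => m _; rewrite -big_split raddf_sum.
apply: eq_bigr => n _.
transitivity (complex.Re (c m * (c n)^* * (weight (g m - g n))%:C%C)).
  by rewrite -zz mulrDr.
by rewrite cc/= mulr0 subr0.
Qed.

(** * Monotonicity and integration through primitives *)

Section primitives.
Context {R : realType}.
Implicit Types f P : R -> R.

Lemma is_derive_continuous f P : (forall a : R, is_derive a 1 P (f a)) ->
  continuous P.
Proof.
move=> dP a; have [dPa _] := dP a.
exact/differentiable_continuous/derivable1_diffP.
Qed.

Lemma is_derive_MVT f P a b : (forall a : R, is_derive a 1 P (f a)) -> a <= b ->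
  exists2 c, a <= c <= b & P b - P a = f c * (b - a).
Proof.
move=> dP ab.
have cP : {within `[a, b], continuous P}.
  exact/continuous_subspaceT/(is_derive_continuous dP).
have [c] := MVT_segment ab (fun x _ => dP x) cP.
by rewrite in_itv => ? ?; exists c.
Qed.

Lemma is_derive_nondecreasing f P : (forall a : R, is_derive a 1 P (f a)) ->
  (forall a, 0 <= f a) -> {homo P : a b / a <= b}.
Proof.
move=> dP f0 a b ab; have [c _ E] := is_derive_MVT dP ab.
by rewrite -subr_ge0 E mulr_ge0// subr_ge0.
Qed.

Lemma integral_FTC2 f P a b : (forall a : R, is_derive a 1 P (f a)) ->
  continuous f -> a <= b ->
  (\int[@lebesgue_measure R]_(x in `[a, b]) (f x)%:E)%E = (P b - P a)%:E.
Proof.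
move=> dP cf; rewrite le_eqVlt => /predU1P[<-|ab].
  by rewrite set_itv1 integral_set1 subrr.
have cP := is_derive_continuous dP.
rewrite (@continuous_FTC2 _ f P)//.
- exact: continuous_subspaceT.
- split.
  + by move=> x _; have [] := dP x.
  + exact/cvg_at_right_filter/cP.
  + exact/cvg_at_left_filter/cP.
- by move=> x _; rewrite derive1E; apply: derive_val.
Qed.

Lemma Rintegral_FTC2 f P a b : (forall a : R, is_derive a 1 P (f a)) ->
  continuous f -> a <= b ->
  \int[@lebesgue_measure R]_(x in `[a, b]) f x = P b - P a.
Proof. by move=> dP cf ab; rewrite /Rintegral (integral_FTC2 dP). Qed.

End primitives.

(** * First and second primitives of a cosine *)

Section cosine_primitives.
Context {R : realType}.
Implicit Types x a : R.

(** Frequency 0 needs its own case: division by zero returns 0, whereas the primitive of the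
    constant 1 is [a]. *)
Definition cos_prim x a := if x == 0 then a else sin (x * a) / x.

Definition cos_prim2 x a :=
  if x == 0 then a ^+ 2 / 2 else (1 - cos (x * a)) / x ^+ 2.

Lemma is_derive_cos_prim x a : is_derive a 1 (cos_prim x) (cos (x * a)).
Proof.
rewrite /cos_prim; have [->|x0] := eqVneq x 0.
  by rewrite mul0r cos0; exact: is_derive_id.
have -> : (fun a => sin (x * a) / x) = x^-1 \*: (sin \o (x \*: id)).
  by apply/funext => b /=; rewrite mulrC.
by apply: is_derive_eq; rewrite /GRing.scale/= mulr1 mulrCA mulVf// mulr1.
Qed.

Lemma is_derive_cos_prim2 x a : is_derive a 1 (cos_prim2 x) (cos_prim x a).
Proof.
rewrite /cos_prim2 /cos_prim; have [_|x0] := eqVneq x 0.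
  have -> : (fun a : R => a ^+ 2 / 2) = 2^-1 \*: (id ^+ 2).
    by apply/funext => b /=; rewrite mulrC fctE.
  by apply: is_derive_eq; rewrite /GRing.scale/=; field.
have -> : (fun a => (1 - cos (x * a)) / x ^+ 2) =
    (x ^+ 2)^-1 \*: (cst 1 - cos \o (x \*: id)).
  by apply/funext => b /=; rewrite mulrC fctE.
by apply: is_derive_eq; rewrite /GRing.scale/=; field.
Qed.

Lemma cos_prim2_ge0 x a : 0 <= cos_prim2 x a.
Proof.
rewrite /cos_prim2; case: ifP => _; first by rewrite divr_ge0 ?sqr_ge0.
by rewrite divr_ge0 ?sqr_ge0// subr_ge0 cos_le1.
Qed.

Lemma cos_prim20 x : cos_prim2 x 0 = 0.
Proof. by rewrite /cos_prim2 mulr0 cos0 subrr expr0n !mul0r if_same. Qed.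

(** The second difference at [a] is [cos (x * a)] times the one at 0, which is nonnegative. *)
Lemma cos_prim2_second_difference x a r :
  cos_prim2 x (a + r) + cos_prim2 x (a - r) - 2 * cos_prim2 x a
    <= 2 * cos_prim2 x r.
Proof.
have -> : cos_prim2 x (a + r) + cos_prim2 x (a - r) - 2 * cos_prim2 x a =
    cos (x * a) * (2 * cos_prim2 x r).
  rewrite /cos_prim2; have [->|x0] := eqVneq x 0.
    by rewrite mul0r cos0; field.
  by rewrite mulrDr mulrBr cosD cosB; field.
by rewrite ler_piMl ?cos_le1// mulr_ge0// cos_prim2_ge0.
Qed.

End cosine_primitives.

(** * Growth of a primitive controlled by second differences *)

Section double_primitive.
Context {R : realType}.
Variables F P Q : R -> R.
Hypothesis dP : forall a : R, is_derive a 1 P (F a).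
Hypothesis dQ : forall a : R, is_derive a 1 Q (P a).
Hypothesis F_ge0 : forall a, 0 <= F a.

Let P_nd : {homo P : a b / a <= b} := is_derive_nondecreasing dP F_ge0.

Lemma primitive_increment_lb a b : a <= b -> P a * (b - a) <= Q b - Q a.
Proof.
move=> ab; have [c /andP[ac _] ->] := is_derive_MVT dQ ab.
by rewrite ler_wpM2r ?subr_ge0// P_nd.
Qed.

Lemma primitive_increment_ub a b : a <= b -> Q b - Q a <= P b * (b - a).
Proof.
move=> ab; have [c /andP[_ cb] ->] := is_derive_MVT dQ ab.
by rewrite ler_wpM2r ?subr_ge0// P_nd.
Qed.

(** The right side is the integral of [P] over [[a, a + r]] minus that over [[a - r, a]]. By
    monotonicity, [P] is at least [P a] and [P (a + r / 2)] on the two halves of the first interval,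
    and at most [P a] on the second. *)
Lemma half_increment_le_second_difference a r : 0 <= r ->
  (P (a + r / 2) - P a) * (r / 2) <= Q (a + r) + Q (a - r) - 2 * Q a.
Proof.
move=> r0.
have := @primitive_increment_lb (a + r / 2) (a + r) ltac:(lra).
have := @primitive_increment_lb a (a + r / 2) ltac:(lra).
have := @primitive_increment_ub (a - r) a ltac:(lra).
have -> : a + r - (a + r / 2) = r / 2 by field.
have -> : a + r / 2 - a = r / 2 by ring.
have -> : a - (a - r) = r by ring.
nra.
Qed.

Hypothesis Q_sd : forall a r, Q (a + r) + Q (a - r) - 2 * Q a <= 2 * Q r.

(** Each step of length [r / 2] costs at most [2 * Q r / (r / 2)], wherever it starts. *)
Lemma primitive_linear_growth r n : 0 < r ->
  P ((r / 2) *+ n) - P 0 <= (4 * (Q r / r)) *+ n.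
Proof.
move=> r0; elim: n => [|n IH]; first by rewrite !mulr0n subrr.
rewrite [in X in P X]mulrSr [leRHS]mulrSr.
suff: P ((r / 2) *+ n + r / 2) - P ((r / 2) *+ n) <= 4 * (Q r / r) by lra.
have h := le_trans (half_increment_le_second_difference ((r / 2) *+ n) (ltW r0))
  (Q_sd _ _).
have r20 : 0 < r / 2 by lra.
rewrite -(ler_pM2r r20); apply: le_trans h _.
by rewrite le_eqVlt; apply/orP; left; apply/eqP; field; rewrite gt_eqF.
Qed.

End double_primitive.

(** * Tent functions as test functions *)

Section tent.
Context {R : realType}.
Implicit Types r x : R.

Definition tent r x := Num.max 0 (1 - `|x| / r).

Lemma continuous_tent r : continuous (tent r).
Proof.
move=> x; apply: (@continuous_max _ _ (cst 0) (fun x => 1 - `|x| / r)).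
  exact: cvg_cst.
apply: cvgB; first exact: cvg_cst.
by apply: cvgMr_tmp; exact: norm_continuous.
Qed.

Lemma tent_ge0 r x : 0 <= tent r x.
Proof. by rewrite /tent le_max lexx. Qed.

Lemma tentE r x : 0 <= x <= r -> tent r x = 1 - x / r.
Proof.
move=> /andP[x0 xr]; rewrite /tent ger0_norm//; apply/max_idPr.
have [r0|r0] := ltP 0 r; first by rewrite subr_ge0 ler_pdivrMr// mul1r.
have -> : x = 0 by lra.
by rewrite mul0r subr0.
Qed.

Lemma tent_eq0 r x : 0 < r -> r <= `|x| -> tent r x = 0.
Proof.
move=> r0 rx; rewrite /tent; apply/max_idPl.
by rewrite subr_le0 ler_pdivlMr// mul1r.
Qed.

Lemma compactly_supported_tent r D : 0 < r -> r < D ->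
  compactly_supported_in (tent r) `]- D, D[.
Proof.
move=> r0 rD.
have sub : closure [set x | tent r x != 0] `<=` `[- r, r].
  have /closure_id -> : closed `[- r, r]%classic by exact: interval_closed.
  apply: closure_subset => x /=.
  rewrite in_itv/= -ler_norml leNgt; apply: contra => rx.
  by rewrite tent_eq0// ltW.
split.
  apply: subclosed_compact sub; first exact: closed_closure.
  exact: segment_compact.
apply: (subset_trans sub) => x/=; rewrite !in_itv/=.
by move=> /andP[? ?]; apply/andP; split; lra.
Qed.

(** Integration by parts on [[0, r]] gives exactly [Q r / r]; the rest of the integrand is
    nonnegative. *)
Lemma Rintegral_tent_ge (F P Q : R -> R) r :
    (forall a : R, is_derive a 1 P (F a)) ->
    (forall a : R, is_derive a 1 Q (P a)) ->
    continuous F -> (forall a, 0 <= F a) -> P 0 = 0 -> Q 0 = 0 -> 0 < r ->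
  Q r / r <= \int[@lebesgue_measure R]_x (tent r x * F x).
Proof.
move=> dP dQ cF F0 P0 Q0 r0.
have ctF : continuous (fun x => tent r x * F x).
  by move=> x; apply: cvgM; [exact: continuous_tent|exact: cF].
have intT : (\int[@lebesgue_measure R]_x (tent r x * F x)%:E =
    \int[@lebesgue_measure R]_(x in `[(- r)%R, r])
      (tent r x * F x)%:E)%E.
  rewrite [RHS]integral_mkcond; apply: eq_integral => x _.
  rewrite patchE; case: ifPn => //; rewrite notin_setE/= in_itv/= -ler_norml.
  by move=> /negP; rewrite -ltNge => /ltW rx; rewrite tent_eq0// mul0r.
(* A real integral is the [fine] part of an extended one, so finiteness is required before
   comparing. *)
have fin : (\int[@lebesgue_measure R]_x (tent r x * F x)%:E)%E \is a fin_num.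
  rewrite intT; apply: integrable_fin_num => //.
  apply: (@continuous_compact_integrable _ (fun x => tent r x * F x)).
    exact: segment_compact.
  exact: continuous_subspaceT.
rewrite -lee_fin /Rintegral fineK//.
have -> : ((Q r / r)%:E = \int[@lebesgue_measure R]_(x in `[0%R, r])
    (tent r x * F x)%:E)%E.
  under eq_integral => x.
    rewrite inE/= in_itv/= => xr; rewrite tentE//; over.
  (* A primitive of [(1 - a / r) * F a], with [G 0 = 0] and [G r = Q r / r]. *)
  pose G := (cst 1 - (r^-1 \*: id)) * P + r^-1 \*: Q.
  have dG (a : R) : is_derive a 1 G ((1 - a / r) * F a).
    have <- : (1 - r^-1 * a) * F a + P a * (0 - r^-1 * 1) + r^-1 * P a =
        (1 - a / r) * F a by field; rewrite gt_eqF.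
    exact: is_derive_eq.
  rewrite (integral_FTC2 dG) ?ltW//.
    congr EFin; rewrite -[G r]/((1 - r^-1 * r) * P r + r^-1 * Q r).
    rewrite -[G 0]/((1 - r^-1 * 0) * P 0 + r^-1 * Q 0) P0 Q0.
    by field; rewrite gt_eqF.
  move=> x; apply: cvgM; last exact: cF.
  by apply: cvgB; [exact: cvg_cst|apply: cvgMr_tmp].
apply: ge0_subset_integral => //.
- by apply/measurable_EFinP; exact: continuous_measurable_fun.
- by move=> x _; rewrite lee_fin mulr_ge0// tent_ge0.
Qed.

End tent.

(** * Finite cosine sums and their primitives *)

Section cosine_sum.
Context {R : realType} (I : Type) (s : seq I) (c x : I -> R).

Let F a := \sum_(i <- s) c i * cos (x i * a).
Let P a := \sum_(i <- s) c i * cos_prim (x i) a.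
Let Q a := \sum_(i <- s) c i * cos_prim2 (x i) a.

Lemma is_derive_lincomb (f df : I -> R -> R) (a : R) :
    (forall i, is_derive a 1 (f i) (df i a)) ->
  is_derive a 1 (fun a => \sum_(i <- s) c i * f i a)
    (\sum_(i <- s) c i * df i a).
Proof.
move=> dfi; elim: s => [|i s' IH].
  rewrite big_nil.
  rewrite (_ : (fun _ => _) = cst 0); first exact: is_derive_cst.
  by apply/funext => b; rewrite big_nil.
rewrite big_cons (_ : (fun _ => _) =
  c i \*: f i + (fun a => \sum_(i <- s') c i * f i a)).
  exact: is_deriveD.
by apply/funext => b; rewrite big_cons.
Qed.

Lemma is_derive_cosine_sum_prim (a : R) : is_derive a 1 P (F a).
Proof.
pose df i a := cos (x i * a).
exact: (@is_derive_lincomb _ df a (fun i => is_derive_cos_prim (x i) a)).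
Qed.

Lemma is_derive_cosine_sum_prim2 (a : R) : is_derive a 1 Q (P a).
Proof.
pose df i a := cos_prim (x i) a.
exact: (@is_derive_lincomb _ df a (fun i => is_derive_cos_prim2 (x i) a)).
Qed.

Lemma cosine_sum_prim0 : P 0 = 0.
Proof.
by apply: big1 => i _; rewrite /cos_prim mulr0 sin0 mul0r if_same mulr0.
Qed.

Lemma cosine_sum_prim20 : Q 0 = 0.
Proof. by apply: big1 => i _; rewrite cos_prim20 mulr0. Qed.

Lemma continuous_cosine_sum : continuous F.
Proof.
pose df i a := - x i * sin (x i * a).
have dcos i (a : R) : is_derive a 1 (fun a => cos (x i * a)) (df i a).
  have d : is_derive a 1 (cos \o (x i \*: id)) (- sin (x i * a) * (x i * 1)).
    exact: is_derive_eq.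
  by move: d; rewrite mulr1 mulNr mulrC -mulNr.
exact: is_derive_continuous 
  (fun a => @is_derive_lincomb _ df a (fun i => dcos i a)).
Qed.

Hypothesis c_ge0 : forall i, 0 <= c i.

Lemma cosine_sum_second_difference a r :
  Q (a + r) + Q (a - r) - 2 * Q a <= 2 * Q r.
Proof.
rewrite /Q !mulr_sumr -big_split -sumrB/=; apply: ler_sum => i _.
have := ler_wpM2l (c_ge0 i) (cos_prim2_second_difference (x i) a r); lra.
Qed.

End cosine_sum.

(** * The form factor at a fixed height as a cosine sum *)

Section form_factor_at.
Context {R : realType} (lam T : R) (gam : R -> nat -> R).
Hypothesis fW : finite_set (window gam T).

Let s : seq nat := fset_set (window gam T).
Let ss := [seq (m, n) | m <- s, n <- s].
Let c (i : nat * nat) := (density lam T)^-1 * weight (gam T i.1 - gam T i.2).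
Let x (i : nat * nat) := lam * (gam T i.1 - gam T i.2) * ln T.

Lemma form_factorE a :
  form_factor lam gam a T = \sum_(i <- ss) c i * cos (x i * a).
Proof.
rewrite big_allpairs /form_factor /pair_sum fsbig_finite//= raddf_sum mulr_sumr.
apply: eq_bigr => m _; rewrite fsbig_finite//= raddf_sum mulr_sumr.
apply: eq_bigr => n _; rewrite /= mulr0 subr0 /c /x/= mulrCA mulrC.
congr (_ * cos _); ring.
Qed.

Hypothesis D_gt0 : 0 < density lam T.

Lemma form_factor_ge0 a : 0 <= form_factor lam gam a T.
Proof.
have := weight_positive_definite s (gam T) (lam * a * ln T).
rewrite form_factorE big_allpairs.
move/(mulr_ge0 (ltW (_ : 0 < (density lam T)^-1))).
rewrite invr_gt0 => /(_ D_gt0); congr (_ <= _); rewrite mulr_sumr.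
apply: eq_bigr => m _; rewrite mulr_sumr; apply: eq_bigr => n _.
rewrite /c /x/= mulrCA mulrC; congr (_ * cos _); ring.
Qed.

(** Each diagonal pair has frequency 0 and weight 1, hence contributes [L ^+ 2 / 2] over the
    density; off-diagonal terms are nonnegative. *)
Lemma diagonal_le_form_factor_prim2 L :
  (wcount gam T)%:R / density lam T * (L ^+ 2 / 2)
    <= \sum_(i <- ss) c i * cos_prim2 (x i) L.
Proof.
rewrite big_allpairs /wcount -sum1_size natr_sum !mulr_suml.
have c_ge0 i : 0 <= c i by rewrite mulr_ge0 ?weight_ge0// invr_ge0 ltW.
rewrite big_seq [leRHS]big_seq; apply: ler_sum => m ms.
rewrite (bigD1_seq m)//=; last exact: fset_uniq.
rewrite ler_wpDr//.
  by apply: sumr_ge0 => n _; rewrite mulr_ge0// cos_prim2_ge0.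
rewrite /c /x/= subrr /weight expr0n/= addr0 divff// mulr0 mul0r.
by rewrite /cos_prim2 eqxx mul1r mulr1.
Qed.

End form_factor_at.

(** * Behaviour for large heights and the lower bound *)

Lemma density_gt0 (R : realType) (lam T : R) : 0 < lam -> 1 < T ->
  0 < density lam T.
Proof.
move=> lam0 T1; rewrite /density mulr_gt0 ?ln_gt0//.
rewrite divr_gt0 ?mulr_gt0 ?pi_gt0//.
exact: lt_trans T1.
Qed.

(** The lower limit is a supremum of infima over neighbourhoods of infinity, so one of these infima
    exceeds [1 - eps]. *)
Lemma assumptionA1_near (R : realType) (lam : R) (gam : R -> nat -> R)
    (eps : R) : assumptionA1 lam gam -> 0 < eps ->
  \forall T \near +oo_R, 1 - eps < (wcount gam T)%:R / density lam T.
Proof.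
rewrite /assumptionA1 limf_einfE => A1 eps0.
have : ((1 - eps)%:E < ereal_sup [set ereal_inf
    ((fun T : R => ((wcount gam T)%:R / density lam T)%:E) @` V)
      | V in +oo_R])%E.
  by rewrite A1 lte_fin; lra.
move/ereal_sup_gt => [_ [V nV <-] lt_inf].
apply: filterS nV => T VT; rewrite -lte_fin; apply: lt_le_trans lt_inf _.
by apply: ereal_inf_lbound; exists T.
Qed.

Theorem theorem2 (R : realType) (T0 lam : R) (gam : R -> nat -> R)
    (gam_fin : forall T : R, T0 <= T -> finite_set (window gam T))
    (lam_gt0 : 0 < lam)
    (A1 : assumptionA1 lam gam)
    (A2 : assumptionA2 lam gam) :
  forall eps b : R, 0 < eps -> 1 <= b ->
  exists ell0 : R, forall ell : R, ell0 <= ell ->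
  exists o1 : R -> R, o1 @ +oo_R --> (0 : R) /\
    \forall T \near +oo_R,
      ell^-1 * (\int[@lebesgue_measure R]_(alpha in `[b, b + ell])
                  form_factor lam gam alpha T)
        > 2^-1 - eps + o1 T.
Proof.
move=> eps b eps0 b1; have [D [D0 [nu nuP]]] := A2.
(* A radius below [D] keeps the closed support of the tent inside the open interval. *)
pose r := D / 2; have r0 : 0 < r by rewrite /r; lra.
have rD : r < D by rewrite /r; lra.
have cvg_nu := nuP _ (@continuous_tent R r) (compactly_supported_tent r0 rD).
(* Strictly above the limit, so it eventually bounds the tent integrals. *)
pose C : R := `|\int[nu]_x tent r x| + 1.
have C0 : 0 < C by rewrite /C ltr_wpDl.
pose n := (Num.trunc (b / (r / 2))).+1.
have bn : b <= (r / 2) *+ n.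
  have r20 : 0 < r / 2 by lra.
  rewrite -mulr_natl -ler_pdivrMr//; apply/ltW/truncnS_gt.
(* The bound for [P b] after [n] steps of length [r / 2]; it depends on neither [T] nor [ell]. *)
pose B := (4 * C) *+ n.
have B0 : 0 <= B by rewrite mulrn_wge0// mulr_ge0// ltW.
(* This makes [B / ell < eps / 2]; the added 1 gives strictness and [ell > 0]. *)
exists (2 * B / eps + 1) => ell ellge.
have ell0 : 0 < ell.
  by apply: lt_le_trans ellge; rewrite ltr_wpDl// divr_ge0 ?mulr_ge0// ltW.
have Bell : 2 * B < eps * ell.
  by rewrite [ltRHS]mulrC -ltr_pdivrMr//; apply: lt_le_trans ellge;
    rewrite ltrDl.
exists (cst 0); split; first exact: cvg_cst.
near=> T.
have fW : finite_set (window gam T).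
  by apply: gam_fin; near: T; apply: nbhs_pinfty_ge; exact: num_real.
have T1 : 1 < T by near: T; apply: nbhs_pinfty_gt; exact: num_real.
have D_gt0 := density_gt0 lam_gt0 T1.
have NT : 1 - eps < (wcount gam T)%:R / density lam T.
  by near: T; exact: assumptionA1_near.
have CT : \int[@lebesgue_measure R]_a (tent r a * form_factor lam gam a T) < C.
  near: T; have := cvgr_lt _ cvg_nu; apply.
  by rewrite /C (le_lt_trans (ler_norm _))// ltrDl.
pose w : seq nat := fset_set (window gam T).
pose s := [seq (m, n) | m <- w, n <- w].
pose c (i : nat * nat) := (density lam T)^-1 * weight (gam T i.1 - gam T i.2).
pose x (i : nat * nat) := lam * (gam T i.1 - gam T i.2) * ln T.
pose F a := \sum_(i <- s) c i * cos (x i * a).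
pose P a := \sum_(i <- s) c i * cos_prim (x i) a.
pose Q a := \sum_(i <- s) c i * cos_prim2 (x i) a.
have FE : (fun a => form_factor lam gam a T) = F.
  by apply/funext => a; exact: form_factorE.
have c_ge0 i : 0 <= c i by rewrite mulr_ge0 ?weight_ge0// invr_ge0 ltW.
have F0 a : 0 <= F a by rewrite -FE; exact: form_factor_ge0.
have cF : continuous F := @continuous_cosine_sum _ _ s c x.
have dP : forall a : R, is_derive a 1 P (F a) :=
  is_derive_cosine_sum_prim s c x.
have dQ : forall a : R, is_derive a 1 Q (P a) :=
  is_derive_cosine_sum_prim2 s c x.
have P0 : P 0 = 0 := cosine_sum_prim0 s c x.
have Q0 : Q 0 = 0 := cosine_sum_prim20 s c x.
have sdQ : forall a r, Q (a + r) + Q (a - r) - 2 * Q a <= 2 * Q r :=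
  cosine_sum_second_difference s x c_ge0.
have Qr : Q r / r <= C.
  apply: le_trans (ltW CT).
  have -> : (fun a => tent r a * form_factor lam gam a T) =
    fun a => tent r a * F a by rewrite -FE.
  exact: Rintegral_tent_ge dP dQ cF F0 P0 Q0 r0.
have Pb : P b <= B.
  apply: le_trans (is_derive_nondecreasing dP F0 bn) _.
  have := primitive_linear_growth dP dQ F0 sdQ n r0.
  rewrite P0 subr0 => /le_trans; apply.
  by rewrite ler_wMn2r// ler_pM2l.
have L0 : 0 < b + ell by lra.
have PL : (wcount gam T)%:R / density lam T * (b + ell) / 2 <= P (b + ell).
  rewrite -(ler_pM2r L0).
  have /(le_trans _) : Q (b + ell) - Q 0 <= P (b + ell) * (b + ell - 0).
    by apply: (primitive_increment_ub dP dQ F0); exact: ltW.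
  rewrite Q0 !subr0; apply.
  have := diagonal_le_form_factor_prim2 gam D_gt0 (b + ell).
  by congr (_ <= _); ring.
have NL : (1 - eps) * ell <= (wcount gam T)%:R / density lam T * (b + ell).
  (* As [1 - eps] may be negative, it is replaced by the nonnegative ratio before [ell] is enlarged
     to [b + ell]. *)
  apply: (@le_trans _ _ ((wcount gam T)%:R / density lam T * ell)).
    by rewrite ler_wpM2r// ltW.
  by rewrite ler_wpM2l ?divr_ge0// ?ltW// ltrDr; lra.
rewrite FE (Rintegral_FTC2 dP cF); last by lra.
(* The increment of [P] is at least [(1 - eps) * ell / 2 - B], and [B < eps * ell / 2]: each loss
   takes half of [eps]. *)
rewrite addr0 mulrC ltr_pdivlMr//; lra.
Unshelve. all: by end_near. Qed.
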